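(* Let $M,N,K\in\mathcal{HS}$ be such that the ratio $x\mapsto \frac{M(x,1)}{N(x,1)}$ (for $x\in\mathbb{R}_+$) is bounded from above. Define $$K_{M,N}(x,y):=K\big(M(x,y),N(x,y)\big)\qquad (x,y\in\mathbb{R}_+).$$ Then $K_{M,N}\in\mathcal{HS}$ and $$\operatorname{lord}(K_{M,N})\ge \big(\operatorname{lord}(M)-\operatorname{uord}(N)\big)\operatorname{lord}(K)+\operatorname{lord}(N),$$ $$\operatorname{uord}(K_{M,N})\le \big(\operatorname{uord}(M)-\operatorname{lord}(N)\big)\operatorname{uord}(K)+\operatorname{uord}(N).$$
   Context: $\mathbb{R}_+:=(0,\infty)$. A (bivariate) mean is an arbitrary function $M\colon\mathbb{R}_+\times\mathbb{R}_+\to\mathbb{R}_+$ with $\min(x,y)\le M(x,y)\le\max(x,y)$ for all $x,y\in\mathbb{R}_+$. It is symmetric if $M(x,y)=M(y,x)$ for all $x,y\in\mathbb{R}_+$, and homogeneous if $M(tx,ty)=tM(x,y)$ for all $x,y,t\in\mathbb{R}_+$. $\mathcal{HS}$ denotes the family of all homogeneous, symmetric means $M\colon\mathbb{R}_+^2\to\mathbb{R}_+$. For $M\in\mathcal{HS}$ the lower order and upper order are the real numbers $$\operatorname{lord}(M):=\sup\Big\{\alpha\in\mathbb{R}\colon \limsup_{x\to0^+}\frac{M(x,1)}{x^\alpha}=0\Big\},\qquad \operatorname{uord}(M):=\inf\Big\{\alpha\in\mathbb{R}\colon \liminf_{x\to0^+}\frac{M(x,1)}{x^\alpha}=\infty\Big\}.$$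 *)

(* Defs.v *)
From HB Require Import structures.
From mathcomp Require Import all_boot all_order all_algebra.
From mathcomp Require Import all_classical all_reals all_analysis.

Set Implicit Arguments.
Unset Strict Implicit.
Unset Printing Implicit Defensive.

Import Order.TTheory GRing.Theory Num.Theory.
Import numFieldNormedType.Exports.

Local Open Scope classical_set_scope.
Local Open Scope ring_scope.

(* A function on (0, oo) x (0, oo) is represented by a curried total function
   R -> R -> R. Its values outside the positive quadrant are irrelevant: every
   condition below is relativized to positive arguments. *)

(* Positivity of the values on the quadrant follows from the lower bound. *)
Definition is_mean (R : realType) (M : R -> R -> R) : Prop :=
  forall x y : R, 0 < x -> 0 < y ->
    Num.min x y <= M x y /\ M x y <= Num.max x y.

Definition symmetric_mean (R : realType) (M : R -> R -> R) : Prop :=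
  forall x y : R, 0 < x -> 0 < y -> M x y = M y x.

Definition homogeneous_mean (R : realType) (M : R -> R -> R) : Prop :=
  forall x y t : R, 0 < x -> 0 < y -> 0 < t -> M (t * x) (t * y) = t * M x y.

Definition HS (R : realType) : set (R -> R -> R) :=
  [set M | [/\ is_mean M, symmetric_mean M & homogeneous_mean M]].

Arguments HS : clear implicits.

(* For M in HS and 0 < x < 1 one has x <= M x 1 <= 1, so the set of exponents
   in lord (resp. uord) contains every negative number (resp. every number
   greater than 1) and is bounded above by 1 (resp. below by 0). Hence the real
   sup and inf never take their default value. *)
Definition lord (R : realType) (M : R -> R -> R) : R :=
  sup [set a : R | limf_esup (fun x : R => (M x 1 / x `^ a)%:E) 0^'+ = 0%:E].

Definition uord (R : realType) (M : R -> R -> R) : R :=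
  inf [set a : R | limf_einf (fun x : R => (M x 1 / x `^ a)%:E) 0^'+ = +oo%E].

Definition compose_means (R : realType) (K M N : R -> R -> R) : R -> R -> R :=
  fun x y => K (M x y) (N x y).

(* Main.v *)
(** The orders only see power bounds near [0+]: [lord M] is the supremum of the
    [a] with [M x 1 = O(x ^ a)], and [uord M] the infimum of the [b] with
    [x ^ b = O(M x 1)]. By homogeneity, with [m = M x 1] and [n = N x 1],
    [K m n = n * K (m / n) 1]. As [m / n] stays in a bounded interval, on which
    a power bound [K t 1 <= C t ^ a] near [0] extends when [a >= 0], one gets
    [K m n <= C m ^ a n ^ (1 - a)], and symmetrically from below. For
    [0 <= a <= 1] this yields
    [lord K_{M,N} >= lord M * lord K + lord N * (1 - lord K)] and the reverse
    inequality for [uord], which are stronger than the claim since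
    [lord N <= uord N]. *)

Require Import Defs.
From HB Require Import structures.
From mathcomp Require Import all_boot all_order all_algebra.
From mathcomp Require Import all_classical all_reals all_analysis.
From mathcomp Require Import ring lra.

Import Order.TTheory GRing.Theory Num.Theory.
Import numFieldNormedType.Exports.

Local Open Scope classical_set_scope.
Local Open Scope ring_scope.

(** * Power bounds near [0+] and the limits of quotients by powers *)

Section PowerBounds.
Context {R : realType}.
Implicit Types (f g : R -> R) (a b : R).

Lemma limf_esup_lt (f : R -> \bar R) (F : set_system R) (y : \bar R) :
  Filter F -> (limf_esup f F < y)%E -> \forall x \near F, (f x < y)%E.
Proof.
move=> FF; rewrite limf_esupE => /ereal_inf_lt[_ [V FV <-]] supVy.
apply: filterS FV => x Vx; apply: le_lt_trans supVy.
by apply: ereal_sup_ubound; exists x.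
Qed.

Lemma limf_esup_le (f : R -> \bar R) (F : set_system R) (y : \bar R) :
  (\forall x \near F, (f x <= y)%E) -> (limf_esup f F <= y)%E.
Proof.
move=> Fy; rewrite limf_esupE; apply: ge_ereal_inf.
exists (ereal_sup (f @` [set x | (f x <= y)%E])); first by exists [set x | (f x <= y)%E].
by apply: ge_ereal_sup => _ [x fxy <-].
Qed.

Lemma limf_esup_ge (f : R -> \bar R) (F : set_system R) (y : \bar R) :
  ProperFilter F -> (\forall x \near F, (y <= f x)%E) -> (y <= limf_esup f F)%E.
Proof.
move=> FF Fy; rewrite limf_esupE; apply: le_ereal_inf_tmp => _ [V FV <-].
have [x [Vx yfx]] := filter_ex (filterI FV Fy).
by apply: le_trans yfx _; apply: ereal_sup_ubound; exists x.
Qed.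

Definition pow_ub f a :=
  exists2 C : R, 0 < C & \forall x \near 0^'+, f x <= C * x `^ a.

Definition pow_lb f a :=
  exists2 c : R, 0 < c & \forall x \near 0^'+, c * x `^ a <= f x.

Lemma near0_pow_le (e a : R) : 0 < e -> 0 < a -> \forall x \near 0^'+, x `^ a <= e.
Proof.
move=> e0 a0; have /cvgrPdist_le /(_ e e0) := powR_cvg0 a0.
by apply: filterS => x; rewrite sub0r normrN ger0_norm ?powR_ge0.
Qed.

Lemma pow_ub_le_lb f a b : pow_ub f a -> pow_lb f b -> a <= b.
Proof.
move=> [C C0 fC] [c c0 cf]; rewrite leNgt; apply/negP => ba.
have ab0 : 0 < a - b by rewrite subr_gt0.
(* If [b < a], the two bounds give [c <= C * x ^ (a - b)] near 0; once [x ^ (a - b) <= c / (2 * C)],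
   the right side is at most [c / 2], a contradiction. *)
have e0 : 0 < c / (2 * C) by rewrite divr_gt0 ?mulr_gt0.
near (0:R)^'+ => x.
have x0 : 0 < x by near: x; exact: nbhs_right_gt.
have : c * x `^ b <= C * x `^ a.
  by apply: (@le_trans _ _ (f x)); near: x.
have -> : a = (a - b) + b by ring.
rewrite powRD ?(gt_eqF x0) ?implybT// mulrA ler_pM2r ?powR_gt0//.
apply/negP; rewrite -ltNge.
have : x `^ (a - b) <= c / (2 * C) by near: x; exact: near0_pow_le.
rewrite ler_pdivlMr ?mulr_gt0// => h.
nra.
Unshelve. all: by end_near. Qed.

Lemma limf_esup_pow_ub f a :
  limf_esup (fun x => (f x / x `^ a)%:E) 0^'+ = 0%E -> pow_ub f a.
Proof.
move=> f0; exists 1 => //.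
have : \forall x \near (0:R)^'+, ((f x / x `^ a)%:E < 1%:E)%E.
  by apply: limf_esup_lt; rewrite f0 lte_fin.
apply: filterS2 (nbhs_right_gt 0) => x x0.
by rewrite lte_fin ltr_pdivrMr ?powR_gt0// => /ltW.
Qed.

(** The quotient is at most [C * x ^ (b - a)], which tends to 0 because [a < b] is strict. With
    [limf_esup_pow_ub], this shows that the exponents defining [lord] and those of upper power
    bounds differ at most by an endpoint. *)
Lemma pow_ub_limf_esup f a b : (\forall x \near 0^'+, 0 <= f x) ->
  pow_ub f b -> a < b -> limf_esup (fun x => (f x / x `^ a)%:E) 0^'+ = 0%E.
Proof.
move=> f0 [C C0 fC] ab; apply/eqP; rewrite eq_le; apply/andP; split; last first.
  apply: limf_esup_ge; apply: filterS f0 => x fx0.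
  by rewrite lee_fin divr_ge0 ?powR_ge0.
apply/lee_addgt0Pr => e e0; rewrite add0e; apply: limf_esup_le.
have ba0 : 0 < b - a by rewrite subr_gt0.
have eC0 : 0 < e / C by rewrite divr_gt0.
near=> x.
have x0 : 0 < x by near: x; exact: nbhs_right_gt.
rewrite lee_fin ler_pdivrMr ?powR_gt0//.
apply: (@le_trans _ _ (C * x `^ b)); first by near: x.
have -> : b = (b - a) + a by ring.
rewrite powRD ?(gt_eqF x0) ?implybT// mulrA ler_pM2r ?powR_gt0//.
by rewrite mulrC -ler_pdivlMr//; near: x; exact: near0_pow_le.
Unshelve. all: by end_near. Qed.

Lemma limf_einf_pow_lb f a :
  limf_einf (fun x => (f x / x `^ a)%:E) 0^'+ = +oo%E -> pow_lb f a.
Proof.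
(* The lower limit is minus the upper limit of the negated function, so that upper limit is [-oo],
   and the negated quotient is eventually below -1. *)
rewrite /limf_einf => /eqP; rewrite eqe_oppLR /= => /eqP f0; exists 1 => //.
have : \forall x \near (0:R)^'+, (- (f x / x `^ a)%:E < (-1)%:E)%E.
  by apply: limf_esup_lt; rewrite f0 ltNyr.
apply: filterS2 (nbhs_right_gt 0) => x x0.
by rewrite -EFinN lte_fin ltrN2 ltr_pdivlMr ?powR_gt0// => /ltW.
Qed.

Lemma pow_lb_limf_einf f a b :
  pow_lb f b -> b < a -> limf_einf (fun x => (f x / x `^ a)%:E) 0^'+ = +oo%E.
Proof.
move=> [c c0 cf] ba; apply/eqyP => A A0.
rewrite /limf_einf leeNr -EFinN; apply: limf_esup_le.
have ab0 : 0 < a - b by rewrite subr_gt0.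
have cA0 : 0 < c / A by rewrite divr_gt0.
near=> x.
have x0 : 0 < x by near: x; exact: nbhs_right_gt.
rewrite -EFinN lee_fin lerN2 ler_pdivlMr ?powR_gt0//.
apply: (@le_trans _ _ (c * x `^ b)); last by near: x.
have -> : a = (a - b) + b by ring.
rewrite powRD ?(gt_eqF x0) ?implybT// mulrA ler_pM2r ?powR_gt0//.
by rewrite mulrC -ler_pdivlMr//; near: x; exact: near0_pow_le.
Unshelve. all: by end_near. Qed.

End PowerBounds.

(** * Means, and their orders expressed by power bounds *)

Section Means.
Set Implicit Arguments.
Unset Strict Implicit.
Context {R : realType}.
Implicit Types (M N K : R -> R -> R) (a b x y t : R).

Lemma mean_gt0 M x y : is_mean M -> 0 < x -> 0 < y -> 0 < M x y.
Proof.
move=> hM x0 y0; have [h _] := hM x y x0 y0.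
by apply: lt_le_trans h; rewrite lt_min x0.
Qed.

Lemma mean_between1 M x : is_mean M -> 0 < x -> x <= 1 -> x <= M x 1 <= 1.
Proof.
move=> hM x0 x1; have [] := hM x 1 x0 ltr01.
by rewrite (min_idPl x1) (max_idPr x1) => -> ->.
Qed.

Lemma mean_pow_ub0 M : is_mean M -> pow_ub (M ^~ 1) 0.
Proof.
move=> hM; exists 1 => //; near=> x.
have x0 : 0 < x by near: x; exact: nbhs_right_gt.
have x1 : x <= 1 by near: x; exact: nbhs_right_le.
rewrite powRr0 mulr1.
have /andP[] // : x <= M x 1 <= 1.
exact: mean_between1.
Unshelve. all: by end_near. Qed.

Lemma mean_pow_lb1 M : is_mean M -> pow_lb (M ^~ 1) 1.
Proof.
move=> hM; exists 1 => //; near=> x.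
have x0 : 0 < x by near: x; exact: nbhs_right_gt.
have x1 : x <= 1 by near: x; exact: nbhs_right_le.
rewrite (powRr1 (ltW x0)) mul1r.
have /andP[] // : x <= M x 1 <= 1.
exact: mean_between1.
Unshelve. all: by end_near. Qed.

Lemma mean_near_ge0 M : is_mean M -> \forall x \near 0^'+, 0 <= M x 1.
Proof.
by move=> hM; apply: filterS (nbhs_right_gt 0) => x x0; exact/ltW/mean_gt0.
Qed.

Lemma lt_lord_pow_ub M a : is_mean M -> a < lord M -> pow_ub (M ^~ 1) a.
Proof.
move=> hM /sup_gt[|b Mb ab].
  (* The set must be nonempty for its supremum to be approached; any exponent below 0 belongs to
     it. *)
  exists (-1); apply: (@pow_ub_limf_esup _ (M ^~ 1) _ 0) => //.
  - exact: mean_near_ge0.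
  - exact: mean_pow_ub0.
apply: limf_esup_pow_ub; apply: (@pow_ub_limf_esup _ (M ^~ 1) _ b) => //.
  exact: mean_near_ge0.
exact: limf_esup_pow_ub.
Qed.

Lemma pow_ub_le_lord M a : is_mean M -> pow_ub (M ^~ 1) a -> a <= lord M.
Proof.
(* The exponent [a] itself may fail to lie in the set defining [lord], but every [a - e] does. *)
move=> hM Ma; apply/ler_addgt0Pr => e e0; rewrite -lerBlDr.
apply: ub_le_sup.
  exists 1 => b Mb; apply: (@pow_ub_le_lb _ (M ^~ 1)).
    exact: limf_esup_pow_ub.
  exact: mean_pow_lb1.
apply: (@pow_ub_limf_esup _ (M ^~ 1) _ a) => //; last by rewrite gtrBl.
exact: mean_near_ge0.
Qed.

Lemma uord_lt_pow_lb M b : is_mean M -> uord M < b -> pow_lb (M ^~ 1) b.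
Proof.
move=> hM /inf_lt[|a Ma ab].
  (* The exponent 1 would not do: [M x 1 / x] stays bounded when [M] is the minimum. *)
  exists 2; apply: (@pow_lb_limf_einf _ (M ^~ 1) _ 1); last by rewrite ltr1n.
  exact: mean_pow_lb1.
apply: limf_einf_pow_lb; apply: (@pow_lb_limf_einf _ (M ^~ 1) _ a) => //.
exact: limf_einf_pow_lb.
Qed.

Lemma pow_lb_uord_le M b : is_mean M -> pow_lb (M ^~ 1) b -> uord M <= b.
Proof.
move=> hM Mb; apply/ler_addgt0Pr => e e0.
apply: ge_inf.
  exists 0 => a Ma; apply: (@pow_ub_le_lb _ (M ^~ 1)).
    exact: mean_pow_ub0.
  exact: limf_einf_pow_lb.
by apply: (@pow_lb_limf_einf _ (M ^~ 1) _ b) => //; rewrite ltrDl.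
Qed.

Lemma lord_ge0 M : is_mean M -> 0 <= lord M.
Proof. by move=> hM; apply: pow_ub_le_lord => //; exact: mean_pow_ub0. Qed.

Lemma uord_le1 M : is_mean M -> uord M <= 1.
Proof. by move=> hM; apply: pow_lb_uord_le => //; exact: mean_pow_lb1. Qed.

Lemma lord_le_uord M : is_mean M -> lord M <= uord M.
Proof.
move=> hM; apply/ler_addgt0Pr => e e0.
have e20 : 0 < e / 2 by rewrite divr_gt0.
have : lord M - e / 2 <= uord M + e / 2.
  apply: (@pow_ub_le_lb _ (M ^~ 1)).
    by apply: lt_lord_pow_ub => //; rewrite gtrBl.
  by apply: uord_lt_pow_lb => //; rewrite ltrDl.
by move=> h; lra.
Qed.

(** * Power bounds for a composed mean *)

Lemma compose_means_HS K M N :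
  HS R K -> HS R M -> HS R N -> HS R (compose_means K M N).
Proof.
move=> [K1 K2 K3] [M1 M2 M3] [N1 N2 N3]; rewrite /compose_means; split.
- move=> x y x0 y0.
  have [Mm MM] := M1 x y x0 y0; have [Nm NM] := N1 x y x0 y0.
  have [Km KM] := K1 _ _ (mean_gt0 M1 x0 y0) (mean_gt0 N1 x0 y0).
  split; first by apply: le_trans Km; rewrite le_min Mm.
  by apply: le_trans KM _; rewrite ge_max MM.
- by move=> x y x0 y0; rewrite M2// N2.
- move=> x y t x0 y0 t0; rewrite M3// N3// K3//; exact: mean_gt0.
Qed.

Lemma compose_meansE K M N x : HS R K -> is_mean M -> is_mean N -> 0 < x ->
  compose_means K M N x 1 = N x 1 * K (M x 1 / N x 1) 1.
Proof.
move=> [_ _ hK] hM hN x0; rewrite /compose_means.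
have Mx := mean_gt0 hM x0 ltr01; have Nx := mean_gt0 hN x0 ltr01.
by rewrite -hK ?divr_gt0// mulr1 mulrC divfK ?gt_eqF.
Qed.

Lemma pow_ub_bounded K a B : is_mean K -> 0 <= a -> pow_ub (K ^~ 1) a ->
  exists2 C, 0 < C & forall t, 0 < t -> t <= B -> K t 1 <= C * t `^ a.
Proof.
move=> hK a0 [C C0 [d /= d0 hd]].
have da := powR_gt0 a d0.
have B1 : 0 < Num.max B 1 by rewrite lt_max ltr01 orbT.
(* The first summand serves for [t < d]. The second serves for [d <= t <= B], where
   [K t 1 <= max B 1] and [d ^ a <= t ^ a]. *)
exists (C + Num.max B 1 / d `^ a); first by rewrite addr_gt0// divr_gt0.
move=> t t0 tB; rewrite mulrDl.
have ta := powR_gt0 a t0.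
have [td|dt] := ltP t d.
  apply: (@le_trans _ _ (C * t `^ a)); last by rewrite lerDl mulr_ge0 ?divr_ge0 ?ltW.
  by apply: hd => //=; rewrite sub0r normrN gtr0_norm.
apply: (@le_trans _ _ (Num.max B 1 / d `^ a * t `^ a)); last first.
  by rewrite lerDr mulr_ge0 ?ltW.
have dat : d `^ a <= t `^ a by rewrite ge0_ler_powR// nnegrE ltW.
have [_ Kt] := hK t 1 t0 ltr01.
apply: le_trans Kt _; apply: (@le_trans _ _ (Num.max B 1)).
  by rewrite ge_max !le_max tB lexx orbT.
by rewrite mulrAC ler_pdivlMr// ler_pM2l.
Qed.

Lemma pow_lb_bounded K b B : is_mean K -> 0 <= b -> 0 < B -> pow_lb (K ^~ 1) b ->
  exists2 c, 0 < c & forall t, 0 < t -> t <= B -> c * t `^ b <= K t 1.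
Proof.
move=> hK b0 B0 [c c0 [d /= d0 hd]].
have Bb := powR_gt0 b B0.
have d1 : 0 < Num.min d 1 by rewrite lt_min d0 ltr01.
(* For [d <= t <= B], [K t 1] is at least [min d 1] while [t ^ b <= B ^ b]. *)
exists (Num.min c (Num.min d 1 / B `^ b)); first by rewrite lt_min c0 divr_gt0.
move=> t t0 tB.
have tb := powR_gt0 b t0.
have [td|dt] := ltP t d.
  apply: (@le_trans _ _ (c * t `^ b)); first by rewrite ler_pM2r// ge_min lexx.
  by apply: hd => //=; rewrite sub0r normrN gtr0_norm.
have tbB : t `^ b <= B `^ b by rewrite ge0_ler_powR// nnegrE ltW.
have [Kt _] := hK t 1 t0 ltr01.
apply: le_trans Kt; apply: (@le_trans _ _ (Num.min d 1 / B `^ b * t `^ b)).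
  by rewrite ler_pM2r// ge_min lexx orbT.
rewrite mulrAC ler_pdivrMr//.
apply: (@le_trans _ _ (Num.min d 1 * B `^ b)); first by rewrite ler_pM2l.
by rewrite ler_pM2r// le_min !ge_min dt lexx orbT.
Qed.

Lemma mul_div_powR (m n a : R) : 0 < m -> 0 < n ->
  n * (m / n) `^ a = m `^ a * n `^ (1 - a).
Proof.
move=> m0 n0.
rewrite powRM ?invr_ge0 ?ltW// -powR_inv1 ?ltW// -powRrM mulN1r.
rewrite powRD ?(gt_eqF n0) ?implybT// powRr1 ?ltW//; ring.
Qed.

(** Raising to nonnegative powers preserves inequalities. The use is with [p = a] and [q = 1 - a],
    whence the restriction of [a] to the unit interval below. *)
Lemma pow_ub_mulX (f g : R -> R) a b p q :
  (\forall x \near 0^'+, 0 <= f x) -> (\forall x \near 0^'+, 0 <= g x) ->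
  0 <= p -> 0 <= q -> pow_ub f a -> pow_ub g b ->
  pow_ub (fun x => f x `^ p * g x `^ q) (a * p + b * q).
Proof.
move=> f0 g0 p0 q0 [C C0 fC] [D D0 gD].
exists (C `^ p * D `^ q); first by rewrite mulr_gt0 ?powR_gt0.
near=> x.
have x0 : 0 < x by near: x; exact: nbhs_right_gt.
have fx0 : 0 <= f x by near: x.
have gx0 : 0 <= g x by near: x.
rewrite powRD ?(gt_eqF x0) ?implybT// !powRrM mulrACA.
rewrite -!powRM ?powR_ge0 ?(ltW C0) ?(ltW D0)//.
have fxC : f x <= C * x `^ a by near: x; exact: fC.
have gxD : g x <= D * x `^ b by near: x; exact: gD.
apply: ler_pM; rewrite ?powR_ge0//.
  by rewrite ge0_ler_powR ?nnegrE// (le_trans fx0).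
by rewrite ge0_ler_powR ?nnegrE// (le_trans gx0).
Unshelve. all: by end_near. Qed.

Lemma pow_lb_mulX (f g : R -> R) a b p q :
  0 <= p -> 0 <= q -> pow_lb f a -> pow_lb g b ->
  pow_lb (fun x => f x `^ p * g x `^ q) (a * p + b * q).
Proof.
move=> p0 q0 [C C0 fC] [D D0 gD].
exists (C `^ p * D `^ q); first by rewrite mulr_gt0 ?powR_gt0.
near=> x.
have x0 : 0 < x by near: x; exact: nbhs_right_gt.
have Cf : C * x `^ a <= f x by near: x; exact: fC.
have Dg : D * x `^ b <= g x by near: x; exact: gD.
have Ca : 0 <= C * x `^ a by rewrite mulr_ge0 ?powR_ge0 ?ltW.
have Db : 0 <= D * x `^ b by rewrite mulr_ge0 ?powR_ge0 ?ltW.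
rewrite powRD ?(gt_eqF x0) ?implybT// !powRrM mulrACA.
rewrite -!powRM ?powR_ge0 ?(ltW C0) ?(ltW D0)//.
apply: ler_pM; rewrite ?powR_ge0//.
  by rewrite ge0_ler_powR ?nnegrE// (le_trans Ca).
by rewrite ge0_ler_powR ?nnegrE// (le_trans Db).
Unshelve. all: by end_near. Qed.

(** The ratio [M x 1 / N x 1] need not tend to 0 with [x], so the bound on [K] near 0 is first
    extended to all [t <= B]. *)
Lemma pow_ub_compose K M N a b c B : HS R K -> is_mean M -> is_mean N ->
  (forall x, 0 < x -> M x 1 / N x 1 <= B) -> 0 <= a <= 1 ->
  pow_ub (K ^~ 1) a -> pow_ub (M ^~ 1) b -> pow_ub (N ^~ 1) c ->
  pow_ub (compose_means K M N ^~ 1) (b * a + c * (1 - a)).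
Proof.
move=> hK hM hN MN /andP[a0 a1] Ka Mb Nc.
have [C C0 KC] := pow_ub_bounded B (let: And3 h _ _ := hK in h) a0 Ka.
have a10 : 0 <= 1 - a by rewrite subr_ge0.
have [D D0 MND] := pow_ub_mulX (mean_near_ge0 hM) (mean_near_ge0 hN) a0 a10 Mb Nc.
exists (C * D); first exact: mulr_gt0.
apply: filterS2 (nbhs_right_gt 0) MND => x x0 MND.
have Mx := mean_gt0 hM x0 ltr01; have Nx := mean_gt0 hN x0 ltr01.
rewrite (compose_meansE hK)//.
apply: (@le_trans _ _ (N x 1 * (C * (M x 1 / N x 1) `^ a))).
  by rewrite ler_pM2l// KC ?divr_gt0 ?MN.
by rewrite mulrCA mul_div_powR// -mulrA ler_pM2l.
Qed.

Lemma pow_lb_compose K M N a b c B : HS R K -> is_mean M -> is_mean N ->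
  0 < B -> (forall x, 0 < x -> M x 1 / N x 1 <= B) -> 0 <= a <= 1 ->
  pow_lb (K ^~ 1) a -> pow_lb (M ^~ 1) b -> pow_lb (N ^~ 1) c ->
  pow_lb (compose_means K M N ^~ 1) (b * a + c * (1 - a)).
Proof.
move=> hK hM hN B0 MN /andP[a0 a1] Ka Mb Nc.
have [C C0 KC] := pow_lb_bounded (let: And3 h _ _ := hK in h) a0 B0 Ka.
have a10 : 0 <= 1 - a by rewrite subr_ge0.
have [D D0 MND] := pow_lb_mulX a0 a10 Mb Nc.
exists (C * D); first exact: mulr_gt0.
apply: filterS2 (nbhs_right_gt 0) MND => x x0 MND.
have Mx := mean_gt0 hM x0 ltr01; have Nx := mean_gt0 hN x0 ltr01.
rewrite (compose_meansE hK)//.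
apply: (@le_trans _ _ (N x 1 * (C * (M x 1 / N x 1) `^ a))); last first.
  by rewrite ler_pM2l// KC ?divr_gt0 ?MN.
by rewrite mulrCA mul_div_powR// -mulrA ler_pM2l.
Qed.

(** * Orders of the composed mean *)

Lemma lord_compose K M N B : HS R K -> HS R M -> HS R N ->
  (forall x, 0 < x -> M x 1 / N x 1 <= B) ->
  lord M * lord K + lord N * (1 - lord K) <= lord (compose_means K M N).
Proof.
move=> hK hM hN MN.
have [K1 _ _] := hK; have [M1 _ _] := hM; have [N1 _ _] := hN.
have [KMN1 _ _] := compose_means_HS hK hM hN.
apply/ler_addgt0Pr => e e0; rewrite -lerBlDr.
have [lK0 lKu uK1] := And3 (lord_ge0 K1) (lord_le_uord K1) (uord_le1 K1).
have [lM0 lMu uM1] := And3 (lord_ge0 M1) (lord_le_uord M1) (uord_le1 M1).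
have [lN0 lNu uN1] := And3 (lord_ge0 N1) (lord_le_uord N1) (uord_le1 N1).
(* The exponent is [lord K - e / 2] cut off at 0, since the composition bound requires [0 <= a]. *)
have [a [a0 aK Ka aeK]] : exists a, [/\ 0 <= a, a <= lord K,
    pow_ub (K ^~ 1) a & lord K - e / 2 <= a].
  have [h|h] := leP (lord K - e / 2) 0.
    by exists 0; split => //; exact: mean_pow_ub0.
  exists (lord K - e / 2); split; [exact: ltW|lra| |by []].
  by apply: lt_lord_pow_ub => //; lra.
have Mb : pow_ub (M ^~ 1) (lord M - e / 2) by apply: lt_lord_pow_ub => //; lra.
have Nc : pow_ub (N ^~ 1) (lord N - e / 2) by apply: lt_lord_pow_ub => //; lra.
have a01 : 0 <= a <= 1 by apply/andP; split => //; lra.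
have := pow_ub_le_lord KMN1 (pow_ub_compose hK M1 N1 MN a01 Ka Mb Nc).
apply: le_trans.
(* This is the loss from replacing [lord K] by [a], with [lord M - lord N <= 1]. Lowering the
   exponents of [M] and [N] costs another [e / 2], as the weights [a] and [1 - a] sum to 1. *)
have : (lord K - a) * (lord M - lord N) <= e / 2 by nra.
by move=> h; nra.
Qed.

Lemma uord_compose K M N B : HS R K -> HS R M -> HS R N -> 0 < B ->
  (forall x, 0 < x -> M x 1 / N x 1 <= B) ->
  uord (compose_means K M N) <= uord M * uord K + uord N * (1 - uord K).
Proof.
move=> hK hM hN B0 MN.
have [K1 _ _] := hK; have [M1 _ _] := hM; have [N1 _ _] := hN.
have [KMN1 _ _] := compose_means_HS hK hM hN.
apply/ler_addgt0Pr => e e0.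
have [lK0 lKu uK1] := And3 (lord_ge0 K1) (lord_le_uord K1) (uord_le1 K1).
have [lM0 lMu uM1] := And3 (lord_ge0 M1) (lord_le_uord M1) (uord_le1 M1).
have [lN0 lNu uN1] := And3 (lord_ge0 N1) (lord_le_uord N1) (uord_le1 N1).
(* Here the cutoff is at 1, to keep the weight [1 - a] nonnegative. *)
have [a [a1 Ka1 Ka aeK]] : exists a, [/\ a <= 1, uord K <= a,
    pow_lb (K ^~ 1) a & a <= uord K + e / 2].
  have [h|h] := leP 1 (uord K + e / 2).
    by exists 1; split => //; exact: mean_pow_lb1.
  exists (uord K + e / 2); split; [exact: ltW|lra| |by []].
  by apply: uord_lt_pow_lb => //; lra.
have Mb : pow_lb (M ^~ 1) (uord M + e / 2) by apply: uord_lt_pow_lb => //; lra.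
have Nc : pow_lb (N ^~ 1) (uord N + e / 2) by apply: uord_lt_pow_lb => //; lra.
have a01 : 0 <= a <= 1 by apply/andP; split => //; lra.
apply: (le_trans (pow_lb_uord_le KMN1 (pow_lb_compose hK M1 N1 B0 MN a01 Ka Mb Nc))).
have : (a - uord K) * (uord M - uord N) <= e / 2 by nra.
by move=> h; nra.
Qed.

End Means.

Theorem theorem3p3 (R : realType) (M N K : R -> R -> R)
  (hM : HS R M) (hN : HS R N) (hK : HS R K)
  (hMN : has_ubound [set M x 1 / N x 1 | x in [set x : R | 0 < x]]) :
  [/\ HS R (compose_means K M N),
      lord (compose_means K M N) >= (lord M - uord N) * lord K + lord N &
      uord (compose_means K M N) <= (uord M - lord N) * uord K + uord N].
Proof.
have [B hB] := hMN.
have MN x : 0 < x -> M x 1 / N x 1 <= B by move=> x0; apply: hB; exists x.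
have [M1 _ _] := hM; have [N1 _ _] := hN; have [K1 _ _] := hK.
have B0 : 0 < B.
  by apply: lt_le_trans (MN 1 ltr01); rewrite divr_gt0// mean_gt0.
have lK0 := lord_ge0 K1; have lKu := lord_le_uord K1.
have lNu := lord_le_uord N1.
split; first exact: compose_means_HS.
  (* The sharper bound exceeds the claimed one by [(uord N - lord N) * lord K], which is
     nonnegative; for [uord] the gap is [(uord N - lord N) * uord K]. *)
  by apply: le_trans (lord_compose hK hM hN MN); nra.
by apply: (le_trans (uord_compose hK hM hN B0 MN)); nra.
Qed.
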